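(* The brackets $e_1,e_2,e_3,e_4$ specified in the context give $W_2=\mathrm{Tot}(\mathcal O_{\mathbb P^1}(-2)\oplus\mathcal O_{\mathbb P^1})$ (pairwise) non-isomorphic Poisson structures.
   Context: $W_2$ is obtained by gluing $U=\mathbb C^3_{\{z,u_1,u_2\}}$ and $V=\mathbb C^3_{\{\xi,v_1,v_2\}}$ by $(\xi,v_1,v_2)=(z^{-1},z^2u_1,u_2)$ where $z,\xi\neq0$. Write $\partial_0=\partial/\partial z$, $\partial_1=\partial/\partial u_1$, $\partial_2=\partial/\partial u_2$. The global holomorphic Poisson structures $e_i$ on $W_2$ are given on $U$ by $$e_1=\partial_2\wedge\partial_0,\quad e_2=u_1\,\partial_1\wedge\partial_2,\quad e_3=z\,\partial_2\wedge\partial_0,\quad e_4=\partial_0\wedge\partial_1 .$$ Two Poisson structures $\pi,\pi'$ on $W_2$ are isomorphic if there is a biholomorphism $\phi:W_2\to W_2$ with $\phi_*\pi=\pi'$. *)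

(* Defs.v *)
From HB Require Import structures.
From mathcomp Require Import all_boot all_order all_algebra.
From mathcomp Require Import all_classical all_reals all_analysis.
From mathcomp Require Import complex.
Set Implicit Arguments.
Unset Strict Implicit.
Unset Printing Implicit Defensive.
Import Order.TTheory GRing.Theory Num.Theory.
Import numFieldNormedType.Exports.
Local Open Scope classical_set_scope.
Local Open Scope ring_scope.

(* The complex numbers, typed as a [numFieldType] so that vectors and matrices
   over them carry their normed-space structure over C; [differentiable],
   ['J f x] and ['D_v f x] below are therefore complex-linear notions. *)
Definition Cplx (R : realType) : numFieldType := R[i].

Notation C3 R := 'rV[Cplx R]_3.

(* Indices of the coordinates (z, u1, u2), resp. (xi, v1, v2). *)
Definition c0 : 'I_3 := inord 0.
Definition c1 : 'I_3 := inord 1.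
Definition c2 : 'I_3 := inord 2.

(* (z, u1, u2) |-> (z^-1, z^2 u1, u2).  The inverse change of coordinates
   (xi, v1, v2) |-> (xi^-1, xi^2 v1, v2) is given by the same formula. *)
Definition transition (R : realType) (x : C3 R) : C3 R :=
  \row_(i < 3) [:: (x 0 c0)^-1; x 0 c0 ^+ 2 * x 0 c1; x 0 c2]`_i.

(* [(false, x)] is the point of U with coordinates x, [(true, x)] the point
   of V with coordinates x. *)
Definition glued (R : realType) (p q : bool * C3 R) : bool :=
  if p.1 == q.1 then p.2 == q.2
  else (p.2 0 c0 != 0) && (q.2 == transition p.2).

Lemma transition0 (R : realType) (x : C3 R) :
  (transition x) 0 c0 = (x 0 c0)^-1.
Proof. by rewrite mxE inordK. Qed.

Lemma transitionK (R : realType) (x : C3 R) :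
  x 0 c0 != 0 -> transition (transition x) = x.
Proof.
move=> x0; apply/rowP => i; rewrite !mxE !inordK //=.
have Hi k (hk : (k < 3)%N) : nat_of_ord i = k -> i = inord k.
  by move=> e; apply: val_inj; rewrite /= inordK.
case E : (nat_of_ord i) (ltn_ord i) => [|[|[|k]]] //= _.
- by rewrite invrK (Hi 0%N).
- by rewrite mulrA -exprMn mulVf // expr1n mul1r (Hi 1%N).
- by rewrite (Hi 2%N).
Qed.

Lemma glued_refl (R : realType) : reflexive (@glued R).
Proof. by move=> p; rewrite /glued !eqxx. Qed.

Lemma glued_sym (R : realType) : symmetric (@glued R).
Proof.
have H (p q : bool * C3 R) : glued p q -> glued q p.
  rewrite /glued (eq_sym q.1); case: ifP => _; first by rewrite eq_sym.
  case/andP => p0 /eqP ->; rewrite transition0 invr_eq0 p0.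
  by rewrite transitionK //= eqxx.
by move=> p q; apply/idP/idP; apply: H.
Qed.

Lemma glued_trans (R : realType) : transitive (@glued R).
Proof.
move=> [b y] [a x] [c z]; rewrite /glued /=.
case: (eqVneq a b) => [<- /eqP <-|ab] //.
case: (eqVneq b c) => [<- xy /eqP <-|bc]; first by rewrite (negPf ab).
have -> : a == c by case: a b c ab bc => [] [] [].
by move=> /andP[x0 /eqP ->] /andP[_ /eqP ->]; rewrite transitionK.
Qed.

Definition glued_equiv (R : realType) : equiv_rel (bool * C3 R) :=
  EquivRel (@glued R) (@glued_refl R) (@glued_sym R) (@glued_trans R).

Definition W2 (R : realType) := quotient_topology {eq_quot (glued_equiv R)}%qT.

(* The parametrization C^3 -> W2 onto U ([a = false]) or V ([a = true]). *)
Definition chart (R : realType) (a : bool) (x : C3 R) : W2 R :=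
  (\pi_(W2 R) (a, x))%qT.

(* Coordinates in a chart; a junk value outside of its image. *)
Definition chart_inv (R : realType) (a : bool) (p : W2 R) : C3 R :=
  xget 0 [set x | chart a x = p].

Definition local_expr (R : realType) (phi : W2 R -> W2 R) (a b : bool)
  : C3 R -> C3 R := chart_inv b \o phi \o chart a.

Definition holomorphic (R : realType) (phi : W2 R -> W2 R) : Prop :=
  continuous phi /\
  forall (a b : bool) (x : C3 R), range (@chart R b) (phi (chart a x)) ->
    differentiable (local_expr phi a b) x.

Definition biholomorphism (R : realType) (phi : W2 R -> W2 R) : Prop :=
  holomorphic phi /\
  exists psi : W2 R -> W2 R,
    [/\ holomorphic psi, cancel phi psi & cancel psi phi].

(* The image of the bivector sum_(i < j) M_ij d_i /\ d_j under the linear map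
   v |-> v *m J on row vectors, which is how ['J f x] represents the
   differential of f at x. *)
Definition push (R : realType) (J M : 'M[Cplx R]_3) : 'M[Cplx R]_3 :=
  J^T *m M *m J.

(* Vanishing of the Schouten bracket of sum_(i < j) P_ij d_i /\ d_j with
   itself, that is, the Jacobi identity for {f, g} = sum_ij P_ij d_i f d_j g. *)
Definition jacobi (R : realType) (P : C3 R -> 'M[Cplx R]_3) : Prop :=
  forall (x : C3 R) (i j k : 'I_3),
    \sum_(l < 3)
      (P x i l * 'D_(delta_mx 0 l) (fun y => P y j k) x +
       P x j l * 'D_(delta_mx 0 l) (fun y => P y k i) x +
       P x k l * 'D_(delta_mx 0 l) (fun y => P y i j) x) = 0.

Record poisson_structure (R : realType) := PoissonStructure {
  bivector :> bool -> C3 R -> 'M[Cplx R]_3;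
  bivector_alternating : forall a x, (bivector a x)^T = - bivector a x;
  bivector_holomorphic : forall a x, differentiable (bivector a) x;
  bivector_glue : forall a (x : C3 R), x 0 c0 != 0 ->
    bivector (~~ a) (transition x)
      = push ('J (@transition R) x) (bivector a x);
  bivector_jacobi : forall a, jacobi (bivector a) }.

Definition is_pushforward (R : realType) (phi : W2 R -> W2 R)
    (P Q : poisson_structure R) : Prop :=
  forall (a b : bool) (x : C3 R), range (@chart R b) (phi (chart a x)) ->
    Q b (local_expr phi a b x) = push ('J (local_expr phi a b) x) (P a x).

Definition poisson_isomorphic (R : realType) (P Q : poisson_structure R) :
    Prop :=
  exists phi : W2 R -> W2 R, biholomorphism phi /\ is_pushforward phi P Q.

(* d_i /\ d_j *)
Definition wedge (R : realType) (i j : 'I_3) : 'M[Cplx R]_3 :=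
  delta_mx i j - delta_mx j i.

Definition e1 (R : realType) (x : C3 R) : 'M[Cplx R]_3 := wedge R c2 c0.
Definition e2 (R : realType) (x : C3 R) : 'M[Cplx R]_3 :=
  x 0 c1 *: wedge R c1 c2.
Definition e3 (R : realType) (x : C3 R) : 'M[Cplx R]_3 :=
  x 0 c0 *: wedge R c2 c0.
Definition e4 (R : realType) (x : C3 R) : 'M[Cplx R]_3 := wedge R c0 c1.

(* Numbered from 0: [brackets i] is the expression on U of e_(i + 1). *)
Definition brackets (R : realType) (i : 'I_4) : C3 R -> 'M[Cplx R]_3 :=
  nth (@e1 R) [:: @e1 R; @e2 R; @e3 R; @e4 R] i.

Definition extends (R : realType) (P : poisson_structure R)
    (E : C3 R -> 'M[Cplx R]_3) : Prop := P false =1 E.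

(* Main.v *)
Require Import Defs.
From HB Require Import structures.
From mathcomp Require Import all_boot all_order all_algebra.
From mathcomp Require Import all_classical all_reals all_analysis.
From mathcomp Require Import complex ring.
Set Implicit Arguments.
Unset Strict Implicit.
Unset Printing Implicit Defensive.
Import Order.TTheory GRing.Theory Num.Theory.
Import numFieldNormedType.Exports.
Local Open Scope classical_set_scope.
Local Open Scope ring_scope.

(** Existence.  On U, the brackets e1, e2, e3 are d/du2 /\ X for the vector
    fields X = d/dz, - u1 d/du1, z d/dz.  These extend to W2: the field
    (a + b z) d/dz + d u1 d/du1 becomes, in the coordinates of V,
    - (a xi^2 + b xi) d/dxi + (2 (a xi + b) + d) v1 d/dv1.  Since X does not
    depend on u2, it commutes with d/du2, and d/du2 /\ X is Poisson
    ([jacobi_vwedge]).  The bracket e4 becomes the constant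
    - d/dxi /\ d/dv1 on V.  By density of the overlap, the expression on U
    determines the one on V ([poisson_determined]).

    Distinction.  The bivectors only transform by the pointwise rule
    Q (f x) = J^T P (x) J, where J is invertible, so an isomorphism matches the
    zeros of the two structures ([pushforward_zeroP]).  The zeros are
    - for e1, the fibre xi = 0;
    - for e2, the surface u1 = 0, v1 = 0;
    - for e3, the disjoint union of the fibre z = 0 and of the line
      xi = v1 = 0;
    - for e4, nothing.
    This isolates e4.  It also isolates e3, whose zeros in U and zeros in V
    are separated by open sets, whereas the zeros of e1 and those of e2 are
    connected: they are a plane, resp. two planes with common points
    ([zero_plane_side]).

    To tell e1 from e2, consider the function u1, which extends to W2 by
    xi^2 v1 on V and is a Casimir of e1: its differential kills the image of
    e1 = d/du2 /\ d/dz.  Let phi carry e2 to e1, and let F be u1 o phi.  Where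
    e2 = u1 d/du1 /\ d/du2 does not vanish, phi lands in U and maps the
    direction d/du1, which lies in the image of e2, into the image of e1, so
    dF (d/du1) = 0 there.  Where e2 vanishes, phi lands in xi = 0, so F = 0.
    Hence along each segment joining a point of u1 = 0 to an arbitrary point in
    the direction d/du1, the function F is constant by the mean value theorem,
    and starts at 0.  Thus F = 0, while phi is onto and u1 is not zero
    ([e2_not_iso_e1]). *)

(** * Differentials of matrix-valued maps *)

Lemma differentiable_mx (K : numFieldType) (V : normedModType K) (m n : nat)
    (f : V -> 'M[K]_(m, n)) x :
  (forall i j, differentiable (fun y => f y i j : K) x) -> differentiable f x.
Proof.
move=> df.
have -> : f = \sum_i \sum_j (fun y => f y i j *: delta_mx i j).
  apply/funext => y; rewrite [LHS]matrix_sum_delta fct_sumE.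
  by apply: eq_bigr => i _; rewrite fct_sumE.
apply: differentiable_sum => i; apply: differentiable_sum => j.
exact: differentiableZl.
Qed.

Lemma differentiable_entry (K : numFieldType) (V : normedModType K) (m n : nat)
    (f : V -> 'M[K]_(m, n)) x i j :
  differentiable f x -> differentiable (fun y => f y i j : K) x.
Proof.
by move=> df; exact: (differentiable_comp df (differentiable_coord _ i j)).
Qed.

Lemma derive_entry (K : numFieldType) (V : normedModType K) (m n : nat)
    (f : V -> 'M[K]_(m, n)) x v i j :
  differentiable f x -> 'D_v (fun y => f y i j : K) x = ('D_v f x) i j.
Proof.
move=> df.
pose g := fun N : 'M[K]_(m, n) => N i j : K.
have gl : linear g by move=> a M N; rewrite /g !mxE.
pose gL : {linear 'M[K]_(m, n) -> K} :=
  HB.pack g (GRing.isLinear.Build _ _ _ _ _ gl).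
have dg : differentiable g (f x) by exact: differentiable_coord.
have gE : 'd g (f x) = g :> ('M[K]_(m, n) -> K).
  by rewrite (_ : g = gL) // diff_lin //; exact: coord_continuous.
rewrite (deriveE _ df) (_ : (fun y => f y i j) = g \o f) //.
rewrite (deriveE _ (differentiable_comp df dg)) (diff_comp df dg) /=.
by rewrite gE.
Qed.

Lemma derive_invariant (K : numFieldType) (V W : normedModType K)
    (f : V -> W) x v :
  (forall h : K, f (h *: v + x) = f x) -> 'D_v f x = 0.
Proof.
move=> fi; rewrite /derive; apply: cvg_lim => //.
by under eq_fun do rewrite /= fi subrr scaler0; exact: cvg_cst.
Qed.

Lemma jacobian_comp (K : numFieldType) (l m n : nat)
    (f : 'rV[K]_l -> 'rV[K]_m) (g : 'rV[K]_m -> 'rV[K]_n) x :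
  differentiable f x -> differentiable g (f x) ->
  'J (g \o f) x = 'J f x *m 'J g (f x).
Proof.
move=> df dg; apply/row_matrixP => i.
rewrite !rowE mulmxA /jacobian !mul_rV_lin1.
by have := congr1 (@^~ (delta_mx 0 i)) (diff_comp df dg).
Qed.

Lemma jacobian_near_id (K : numFieldType) (n : nat)
    (f : 'rV[K]_n -> 'rV[K]_n) x :
  differentiable f x -> (\forall x' \near x, f x' = x') -> 'J f x = 1%:M.
Proof.
move=> df fid; apply/row_matrixP => i.
rewrite rowE -deriveEjacobian // row1 -[RHS](derive_id x).
exact: near_eq_derive.
Qed.

(** * Coordinates on C^3 *)

Lemma ordP3 (P : 'I_3 -> Prop) : P c0 -> P c1 -> P c2 -> forall i, P i.
Proof.
move=> P0 P1 P2 [[|[|[|k]]] hk] //.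
- by rewrite (_ : Ordinal hk = c0) //; apply: val_inj; rewrite /= inordK.
- by rewrite (_ : Ordinal hk = c1) //; apply: val_inj; rewrite /= inordK.
- by rewrite (_ : Ordinal hk = c2) //; apply: val_inj; rewrite /= inordK.
Qed.

Lemma coords_distinct :
  ((c0 == c1) = false) * ((c0 == c2) = false) * ((c1 == c2) = false) *
  ((c1 == c0) = false) * ((c2 == c0) = false) * ((c2 == c1) = false).
Proof. by do !split; apply/eqP => /(congr1 val); rewrite /= !inordK. Qed.

Local Notation basis i := (delta_mx 0 i : 'rV_3).

Definition row3 (K : nzRingType) (a b c : K) : 'rV[K]_3 :=
  a *: basis c0 + b *: basis c1 + c *: basis c2.

Lemma row3E (K : nzRingType) (a b c : K) :
  (row3 a b c 0 c0 = a) * (row3 a b c 0 c1 = b) * (row3 a b c 0 c2 = c).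
Proof.
rewrite /row3 !mxE !eqxx !coords_distinct /=.
by rewrite !mulr1 !mulr0 !addr0 !add0r.
Qed.

Lemma basis0E (K : nzRingType) : basis c0 = row3 1 0 0 :> 'rV[K]_3.
Proof. by rewrite /row3 !scale0r !addr0 scale1r. Qed.

Lemma basis1E (K : nzRingType) : basis c1 = row3 0 1 0 :> 'rV[K]_3.
Proof. by rewrite /row3 !scale0r addr0 add0r scale1r. Qed.

Lemma basis2E (K : nzRingType) : basis c2 = row3 0 0 1 :> 'rV[K]_3.
Proof. by rewrite /row3 !scale0r !add0r scale1r. Qed.

Lemma eq_row3 (K : nzRingType) (u v : 'rV[K]_3) :
  u 0 c0 = v 0 c0 -> u 0 c1 = v 0 c1 -> u 0 c2 = v 0 c2 -> u = v.
Proof. by move=> *; apply/rowP; elim/ordP3. Qed.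

Lemma transitionE (R : realType) (x : C3 R) :
  (transition x 0 c0 = (x 0 c0)^-1) *
  (transition x 0 c1 = x 0 c0 ^+ 2 * x 0 c1) *
  (transition x 0 c2 = x 0 c2).
Proof. by rewrite !mxE !inordK. Qed.

Lemma differentiable_coordinate (R : realType) (x : C3 R) (i : 'I_3) :
  differentiable (fun y : C3 R => y 0 i) x.
Proof. exact: differentiable_coord. Qed.

Lemma derivable_coordinate (R : realType) (x v : C3 R) (i : 'I_3) :
  derivable (fun y : C3 R => y 0 i) x v.
Proof. exact/diff_derivable/differentiable_coordinate. Qed.

Lemma derive_coordinate (R : realType) (x v : C3 R) (i : 'I_3) :
  'D_v (fun y : C3 R => y 0 i) x = v 0 i.
Proof. by rewrite (derive_entry (f := id)) // derive_id. Qed.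

Lemma differentiable_row3 (R : realType) (f g h : C3 R -> Cplx R) x :
  differentiable f x -> differentiable g x -> differentiable h x ->
  differentiable (fun y => row3 (f y) (g y) (h y)) x.
Proof.
by move=> df dg dh; apply: differentiable_mx => i; rewrite (ord1 i); elim/ordP3;
  under eq_fun do rewrite row3E.
Qed.

(** * Decomposable bivectors *)

Definition vwedge (K : nzRingType) (n : nat) (u v : 'rV[K]_n) : 'M[K]_n :=
  u^T *m v - v^T *m u.

Lemma wedgeE (R : realType) i j : wedge R i j = vwedge (basis i) (basis j).
Proof. by rewrite /wedge /vwedge !trmx_delta !mul_delta_mx. Qed.

Lemma vwedgeE (K : nzRingType) (n : nat) (u v : 'rV[K]_n) i j :
  vwedge u v i j = u 0 i * v 0 j - v 0 i * u 0 j.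
Proof. by rewrite !mxE !big_ord1 !mxE. Qed.

Lemma vwedgeC (K : nzRingType) (n : nat) (u v : 'rV[K]_n) :
  vwedge u v = - vwedge v u.
Proof. by rewrite /vwedge opprB. Qed.

Lemma vwedgeZr (K : comNzRingType) (n : nat) (a : K) (u v : 'rV[K]_n) :
  vwedge u (a *: v) = a *: vwedge u v.
Proof.
by rewrite /vwedge [(a *: _)^T]linearZ /= scalerBr scalemxAr scalemxAl.
Qed.

Lemma trmx_vwedge (R : realType) (u v : C3 R) : (vwedge u v)^T = - vwedge u v.
Proof. by rewrite /vwedge linearB /= !trmx_mul !trmxK opprB. Qed.

Lemma push_vwedge (R : realType) (J : 'M[Cplx R]_3) (u v : C3 R) :
  push J (vwedge u v) = vwedge (u *m J) (v *m J).
Proof. by rewrite /push /vwedge mulmxBr mulmxBl !trmx_mul !mulmxA. Qed.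

Lemma differentiable_vwedge (R : realType) (u : C3 R) (X : C3 R -> C3 R) x :
  differentiable X x -> differentiable (fun y => vwedge u (X y)) x.
Proof.
move=> dX; have D i := differentiable_entry 0 i dX.
apply: differentiable_mx => i j.
under eq_fun do rewrite vwedgeE (mulrC (X _ 0 i)).
exact: (differentiableB (differentiableZ (u 0 i) (D j))
  (differentiableZ (u 0 j) (D i))).
Qed.

Lemma vwedge_e2_eq0 (K : fieldType) (p q : K) :
  vwedge (basis c2) (row3 p q 0) = 0 <-> p = 0 /\ q = 0.
Proof.
have e2 := basis2E K.
split=> [H|[-> ->]]; last first.
  by rewrite /row3 !scale0r !addr0 /vwedge mulmx0 trmx0 mul0mx subr0.
split.
  have := congr1 (fun M : 'M[K]_3 => M c2 c0) H.
  by rewrite vwedgeE e2 !row3E mul1r mulr0 subr0 mxE.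
have := congr1 (fun M : 'M[K]_3 => M c2 c1) H.
by rewrite vwedgeE e2 !row3E mul1r mulr0 subr0 mxE.
Qed.

Lemma vwedge_e01_neq0 (K : fieldType) :
  vwedge (basis c0) (basis c1) <> 0 :> 'M[K]_3.
Proof.
rewrite (congr2 (@vwedge K 3) (basis0E K) (basis1E K)).
move/(congr1 (fun M : 'M[K]_3 => M c0 c1)).
rewrite vwedgeE !row3E mulr1 mulr0 subr0 mxE => /eqP.
by rewrite oner_eq0.
Qed.

(** The linear algebra behind the Casimir argument: if an invertible J maps the
    bivector q e_2 /\ e_1 to e_2 /\ v, where the linear form of index c1 kills
    e_2 and v, then this form also kills the image e_1 J. *)
Lemma vwedge_mul_coord_eq0 (K : fieldType) (J J' : 'M[K]_3) (q : K)
    (v : 'rV[K]_3) :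
  J *m J' = 1%:M -> q != 0 -> v 0 c1 = 0 ->
  vwedge (basis c2) v = vwedge (basis c2 *m J) (q *: (basis c1 *m J)) ->
  (basis c1 *m J) 0 c1 = 0.
Proof.
move=> JJ q0 v1; set u := basis c2 *m J; set w := basis c1 *m J => E.
have e21 : (basis c2 : 'rV[K]_3) 0 c1 = 0.
  by rewrite (_ : basis c2 = row3 0 0 1) ?row3E //; exact: basis2E.
(* The column of index c1 of the hypothesis vanishes on the left, and is
   proportional to w_1 u - u_1 w on the right. *)
have H : w 0 c1 *: u = u 0 c1 *: w.
  apply/rowP => i; have := congr1 (fun M : 'M[K]_3 => M i c1) E.
  have sE (k : K) (r : 'rV[K]_3) : (k *: r) 0 i = k * r 0 i by rewrite mxE.
  have ME (k : K) (M : 'M[K]_3) : (k *: M) i c1 = k * M i c1 by rewrite mxE.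
  rewrite vwedgeZr ME !vwedgeE v1 e21 mulr0 mulr0 subrr => /esym/eqP.
  by rewrite mulf_eq0 (negPf q0) /= subr_eq0 !sE mulrC (mulrC (u 0 c1)) => /eqP.
(* Cancelling J leaves w_1 e_2 = u_1 e_1, whence w_1 = 0. *)
have := congr1 (fun r => r *m J') H.
rewrite -!scalemxAl -!mulmxA JJ !mulmx1 => /rowP/(_ c2).
rewrite !mxE !eqxx /= mulr1.
by rewrite coords_distinct mulr0.
Qed.

(** If d_2 commutes with X, then [d_2 /\ X, d_2 /\ X] = 0.  Concretely, with
    S_k the derivative of X_k along X and d_i the Kronecker symbol of i = 2,
    each of the three terms of the Jacobi identity sums to
    d_i (d_j S_k - d_k S_j), and the cyclic sum cancels. *)
Lemma jacobi_vwedge (R : realType) (X : C3 R -> C3 R) :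
  (forall x, differentiable X x) ->
  (forall (h : Cplx R) (x : C3 R), X (h *: basis c2 + x) = X x) ->
  jacobi (fun x => vwedge (basis c2) (X x)).
Proof.
move=> dX X2 x.
pose S k := \sum_l X x 0 l * 'D_(basis l) (fun y => X y 0 k) x.
pose d (i : 'I_3) : Cplx R := (basis c2 : C3 R) 0 i.
have DX l j k : 'D_(basis l) (fun y => vwedge (basis c2) (X y) j k) x =
  d j * 'D_(basis l) (fun y => X y 0 k) x -
  d k * 'D_(basis l) (fun y => X y 0 j) x.
  have D i : derivable (fun y => X y 0 i : Cplx R) x (basis l).
    exact/diff_derivable/(differentiable_entry 0 i (dX x)).
  under eq_fun do rewrite vwedgeE (mulrC (X _ 0 j)).
  have -> : (fun y => basis c2 0 j * X y 0 k - basis c2 0 k * X y 0 j) =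
    d j *: (fun y => X y 0 k : Cplx R) -
    d k *: (fun y => X y 0 j : Cplx R) by [].
  rewrite deriveB ?deriveZ //; exact: derivableZ.
have T i j k : \sum_l vwedge (basis c2) (X x) i l *
      'D_(basis l) (fun y => vwedge (basis c2) (X y) j k) x
   = d i * (d j * S k - d k * S j).
  have E0 j' : 'D_(basis c2) (fun y => X y 0 j') x = 0.
    by apply: derive_invariant => h; rewrite X2.
  rewrite /S (big_distrr (d j)) (big_distrr (d k)) /= -sumrB big_distrr /=.
  apply: eq_bigr => l _; rewrite DX vwedgeE -/(d i) -/(d l).
  have [->|l2] := eqVneq l c2; first by rewrite !E0 !mulr0 subrr !mulr0.
  rewrite [d l](_ : _ = 0) ?mulr0 ?subr0.
    have AC (a b c e p q : Cplx R) :
      a * b * (c * p - e * q) = a * (c * (b * p) - e * (b * q)) by ring.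
    exact: AC.
  by rewrite /d mxE (negPf l2).
move=> i j k.
have S3 (F G H : 'I_3 -> Cplx R) a b c : \sum_l F l = a -> \sum_l G l = b ->
    \sum_l H l = c -> \sum_l (F l + G l + H l) = a + b + c.
  by move=> <- <- <-; rewrite !big_split.
apply: etrans (S3 _ _ _ _ _ _ (T i j k) (T j k i) (T k i j)) _.
by move: (d i) (d j) (d k) (S i) (S j) (S k) => a b c p q r; ring.
Qed.

(** * The differential of the change of coordinates *)

Lemma transition_differentiable (R : realType) (x : C3 R) :
  x 0 c0 != 0 -> differentiable (@transition R) x.
Proof.
move=> x0; apply: differentiable_mx => i; rewrite (ord1 i).
elim/ordP3.
- under eq_fun do rewrite transitionE.
  apply: (@differentiableV _ _ (fun y : C3 R => y 0 c0)) => //.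
  exact: differentiable_coordinate.
- under eq_fun do rewrite transitionE.
  have D i := differentiable_coordinate x i.
  exact: (differentiableM (differentiableX 1 (D c0)) (D c1)).
- under eq_fun do rewrite transitionE.
  exact: differentiable_coordinate.
Qed.

Lemma mul_jacobian_transition (R : realType) (x v : C3 R) : x 0 c0 != 0 ->
  v *m 'J (@transition R) x =
    row3 (- (x 0 c0) ^- 2 * v 0 c0)
      (x 0 c0 ^+ 2 * v 0 c1 + 2 * x 0 c0 * x 0 c1 * v 0 c0) (v 0 c2).
Proof.
move=> x0; have dt := transition_differentiable x0.
rewrite -(deriveEjacobian _ dt); apply/rowP.
elim/ordP3; rewrite row3E -derive_entry //.
- under eq_fun do rewrite transitionE.
  by rewrite deriveV ?derive_coordinate //; exact: derivable_coordinate.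
- under eq_fun do rewrite transitionE.
  have -> : (fun y : C3 R => y 0 c0 ^+ 2 * y 0 c1) =
    (fun y : C3 R => y 0 c0) ^+ 2 * (fun y : C3 R => y 0 c1) by [].
  have D i : derivable (fun y : C3 R => y 0 i) x v.
    exact: derivable_coordinate.
  rewrite (deriveM (derivableX (n := 2) (D c0)) (D c1)) (deriveX _ (D c0)).
  by rewrite !derive_coordinate /GRing.scale /= expr1 mulrCA mulrA.
- under eq_fun do rewrite transitionE.
  by rewrite derive_coordinate.
Qed.

Lemma row3_mul_jacobian_transition (R : realType) (p q r : Cplx R) (x : C3 R) :
  x 0 c0 != 0 -> row3 p q r *m 'J (@transition R) x =
    row3 (- (x 0 c0) ^- 2 * p) (x 0 c0 ^+ 2 * q + 2 * x 0 c0 * x 0 c1 * p) r.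
Proof.
have [[e0 e1] e2] := row3E p q r.
by move=> x0; rewrite (mul_jacobian_transition _ x0) e0 e1 e2.
Qed.

Lemma e2_mul_jacobian_transition (R : realType) (x : C3 R) : x 0 c0 != 0 ->
  basis c2 *m 'J (@transition R) x = basis c2.
Proof.
move=> x0; rewrite (_ : basis c2 = row3 0 0 1); last exact: basis2E.
by rewrite (row3_mul_jacobian_transition _ _ _ x0) !mulr0 addr0.
Qed.

Lemma transition_neq0 (R : realType) (x : C3 R) :
  x 0 c0 != 0 -> (transition x) 0 c0 != 0.
Proof. by rewrite transition0 invr_eq0. Qed.

Lemma near_coord0_neq0 (R : realType) (x : C3 R) :
  x 0 c0 != 0 -> \forall y \near x, (y : C3 R) 0 c0 != 0.
Proof.
move=> x0.
have H : (fun y : C3 R => y 0 c0) @ x --> x 0 c0 by exact: coord_continuous.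
exact: (cvgr_neq0 _ H x0).
Qed.

Lemma jacobian_transitionK (R : realType) (x : C3 R) : x 0 c0 != 0 ->
  'J (@transition R) (transition x) *m 'J (@transition R) x = 1%:M.
Proof.
move=> x0; apply: mulmx1C.
have d1 := transition_differentiable x0.
have d2 := transition_differentiable (transition_neq0 x0).
rewrite -(jacobian_comp d1 d2).
apply: (jacobian_near_id (differentiable_comp d1 d2)).
near=> y; apply: transitionK; near: y; exact: near_coord0_neq0.
Unshelve. all: by end_near.
Qed.

Lemma push_inverse (R : realType) (J K M : 'M[Cplx R]_3) :
  J *m K = 1%:M -> push K (push J M) = M.
Proof.
move=> JK; rewrite /push !mulmxA -trmx_mul JK trmx1 mul1mx -mulmxA JK mulmx1 //.
Qed.

(** * Poisson structures on W2 given by their expressions in the charts *)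

(** The change of coordinates being an involution, the gluing identity from U
    to V implies the one from V to U. *)
Lemma poisson_glue (R : realType) (U V : C3 R -> 'M[Cplx R]_3) :
  (forall x, (U x)^T = - U x) -> (forall x, (V x)^T = - V x) ->
  (forall x, differentiable U x) -> (forall x, differentiable V x) ->
  jacobi U -> jacobi V ->
  (forall x : C3 R, x 0 c0 != 0 ->
    V (transition x) = push ('J (@transition R) x) (U x)) ->
  exists P : poisson_structure R, P false =1 U /\ P true =1 V.
Proof.
move=> aU aV dU dV jU jV g.
have g' (x : C3 R) : x 0 c0 != 0 ->
    U (transition x) = push ('J (@transition R) x) (V x).
  move=> x0; have := g _ (transition_neq0 x0); rewrite (transitionK x0) => ->.
  exact: (esym (push_inverse _ (jacobian_transitionK x0))).
pose B a := if a then V else U.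
have aB a x : (B a x)^T = - B a x by case: a; [exact: aV|exact: aU].
have dB a x : differentiable (B a) x by case: a; [exact: dV|exact: dU].
have gB a (x : C3 R) : x 0 c0 != 0 ->
    B (~~ a) (transition x) = push ('J (@transition R) x) (B a x).
  by case: a => x0; [exact: g'|exact: g].
have jB a : jacobi (B a) by case: a; [exact: jV|exact: jU].
by exists (PoissonStructure aB dB gB jB); split.
Qed.

Lemma continuous_eq_off (R : realType) (W : normedModType (Cplx R))
    (f g : C3 R -> W) :
  continuous f -> continuous g ->
  (forall y : C3 R, y 0 c0 != 0 -> f y = g y) -> f =1 g.
Proof.
move=> cf cg fg y.
have [y0|] := eqVneq (y 0 c0) 0; last exact: fg.
pose p (h : Cplx R) : C3 R := h *: basis c0 + y.
have cp : p h @[h --> 0^'] --> y.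
  apply: cvg_trans (_ : p h @[h --> (0 : Cplx R)] --> y).
    by apply: cvg_fmap2; exact: cvg_within.
  rewrite -[X in _ --> X](_ : p 0 = y); last by rewrite /p scale0r add0r.
  apply: (@continuousD _ _ _ (fun h : Cplx R => h *: (basis c0 : C3 R))
    (cst y)).
    exact: scalel_continuous.
  exact: cst_continuous.
have Hf : f (p h) @[h --> 0^'] --> f y by apply: cvg_comp cp _; exact: cf.
have Hg : g (p h) @[h --> 0^'] --> g y by apply: cvg_comp cp _; exact: cg.
apply: (norm_cvg_unique Hf).
apply: cvg_trans Hg; apply: near_eq_cvg.
near=> h; apply/esym/fg; rewrite /p !mxE y0 addr0 !eqxx mulr1.
near: h; exact: nbhs_dnbhs_neq.
Unshelve. all: by end_near.
Qed.

(** Gluing prescribes the expression on V where xi <> 0, a dense set. *)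
Lemma poisson_determined (R : realType) (P Q : poisson_structure R) :
  P false =1 Q false -> P true =1 Q true.
Proof.
move=> PQ; apply: continuous_eq_off.
- by move=> y; exact/differentiable_continuous/bivector_holomorphic.
- by move=> y; exact/differentiable_continuous/bivector_holomorphic.
move=> y y0; have y0' := transition_neq0 y0.
have := bivector_glue P false y0'; have := bivector_glue Q false y0'.
by rewrite /negb (transitionK y0) PQ => -> ->.
Qed.

(** The vector field (a + b z) d/dz + d u1 d/du1 on U. *)
Definition vfieldU (R : realType) (a b d : Cplx R) (x : C3 R) : C3 R :=
  row3 (a + b * x 0 c0) (d * x 0 c1) 0.

(** The expression on V of the field [vfieldU a b d]; see [vfield_glue]. *)
Definition vfieldV (R : realType) (a b d : Cplx R) (x : C3 R) : C3 R :=
  row3 (- (a * x 0 c0 ^+ 2 + b * x 0 c0))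
    ((2 * (a * x 0 c0 + b) + d) * x 0 c1) 0.

Lemma vfield_transition (K : fieldType) (a b d u z : K) : z != 0 ->
  - z ^- 2 * (a + b * z) = - (a * z^-1 ^+ 2 + b * z^-1) /\
  z ^+ 2 * (d * u) + 2 * z * u * (a + b * z) =
    (2 * (a * z^-1 + b) + d) * (z ^+ 2 * u).
Proof. by move=> z0; split; field. Qed.

Lemma vfield_glue (R : realType) (a b d : Cplx R) (x : C3 R) : x 0 c0 != 0 ->
  vfieldU a b d x *m 'J (@transition R) x = vfieldV a b d (transition x).
Proof.
move=> x0; rewrite /vfieldV !transitionE /vfieldU.
rewrite (row3_mul_jacobian_transition _ _ _ x0).
by have [-> ->] := vfield_transition a b d (x 0 c1) x0.
Qed.

Lemma differentiable_vfieldU (R : realType) (a b d : Cplx R) x :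
  differentiable (vfieldU a b d) x.
Proof.
have D i := differentiable_coordinate x i.
apply: differentiable_row3; last exact: differentiable_cst.
  exact: (differentiableD (differentiable_cst a x) (differentiableZ b (D c0))).
exact: (differentiableZ d (D c1)).
Qed.

Lemma differentiable_vfieldV (R : realType) (a b d : Cplx R) x :
  differentiable (vfieldV a b d) x.
Proof.
have D i := differentiable_coordinate x i.
apply: differentiable_row3; last exact: differentiable_cst.
  exact: (differentiableN (differentiableD
    (differentiableZ a (differentiableX 1 (D c0))) (differentiableZ b (D c0)))).
exact: (differentiableM (differentiableD (differentiableZ 2 (differentiableD
    (differentiableZ a (D c0)) (differentiable_cst b x)))
    (differentiable_cst d x)) (D c1)).
Qed.

Lemma coord_add_e2 (R : realType) (h : Cplx R) (x : C3 R) :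
  ((h *: basis c2 + x) 0 c0 = x 0 c0) * ((h *: basis c2 + x) 0 c1 = x 0 c1).
Proof.
rewrite (_ : h *: basis c2 = row3 0 0 h); last first.
  by rewrite /row3 !scale0r !add0r.
by rewrite ![(row3 0 0 h + x) _ _]mxE !row3E !add0r.
Qed.

Lemma vfield_poisson (R : realType) (a b d : Cplx R) :
  exists P : poisson_structure R,
    P false =1 (fun x => vwedge (basis c2) (vfieldU a b d x)) /\
    P true =1 (fun x => vwedge (basis c2) (vfieldV a b d x)).
Proof.
apply: poisson_glue.
- by move=> x; rewrite trmx_vwedge.
- by move=> x; rewrite trmx_vwedge.
- by move=> x; exact/differentiable_vwedge/differentiable_vfieldU.
- by move=> x; exact/differentiable_vwedge/differentiable_vfieldV.
- apply: jacobi_vwedge; first exact: differentiable_vfieldU.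
  by move=> h x; rewrite /vfieldU !coord_add_e2.
- apply: jacobi_vwedge; first exact: differentiable_vfieldV.
  by move=> h x; rewrite /vfieldV !coord_add_e2.
move=> x x0; rewrite push_vwedge (vfield_glue _ _ _ x0).
by rewrite (e2_mul_jacobian_transition x0).
Qed.

Lemma vfield_poisson_V (R : realType) (P : poisson_structure R)
    (a b d : Cplx R) :
  P false =1 (fun x => vwedge (basis c2) (vfieldU a b d x)) ->
  P true =1 (fun x => vwedge (basis c2) (vfieldV a b d x)).
Proof.
move=> PU x; have [Q [QU QV]] := vfield_poisson a b d.
rewrite -QV; apply: poisson_determined => y; exact: etrans (PU y) (esym (QU y)).
Qed.

Lemma vwedge01_transition (K : fieldType) (J : 'M[K]_3) (z t : K) : z != 0 ->
  (forall p q r,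
    row3 p q r *m J = row3 (- z ^- 2 * p) (z ^+ 2 * q + t * p) r) ->
  vwedge (basis c0 *m J) (basis c1 *m J) = - vwedge (basis c0) (basis c1).
Proof.
move=> z0 mulJ.
have e0 := basis0E K; have e1 := basis1E K.
rewrite e0 e1 !mulJ; apply/matrixP; elim/ordP3; elim/ordP3;
  by rewrite [RHS]mxE !vwedgeE !row3E; field.
Qed.

Lemma e4_poisson (R : realType) :
  exists P : poisson_structure R,
    P false =1 @e4 R /\ P true =1 (fun=> - wedge R c0 c1).
Proof.
have J0 (M : 'M[Cplx R]_3) : jacobi (fun=> M).
  move=> x i j k; rewrite big1 // => l _.
  by rewrite !derive_cst !mulr0 !addr0.
apply: poisson_glue.
- by move=> x; rewrite /e4 wedgeE trmx_vwedge.
- by move=> x; rewrite linearN /= wedgeE trmx_vwedge.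
- by move=> x; exact: differentiable_cst.
- by move=> x; exact: differentiable_cst.
- exact: J0.
- exact: J0.
move=> x x0; rewrite /e4 wedgeE push_vwedge.
have mulJ p q r := row3_mul_jacobian_transition p q r x0.
by rewrite (vwedge01_transition x0 mulJ).
Qed.

Lemma e1E (R : realType) (x : C3 R) :
  e1 x = vwedge (basis c2) (vfieldU 1 0 0 x).
Proof.
have -> : vfieldU 1 0 0 x = basis c0.
  rewrite /vfieldU mul0r mul0r addr0; exact: esym (basis0E _).
exact: wedgeE.
Qed.

Lemma e2E (R : realType) (x : C3 R) :
  e2 x = vwedge (basis c2) (vfieldU 0 0 (-1) x).
Proof.
have -> : vfieldU 0 0 (-1) x = - x 0 c1 *: basis c1.
  by rewrite /vfieldU mul0r addr0 mulN1r /row3 !scale0r addr0 add0r.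
by rewrite vwedgeZr vwedgeC scaleNr scalerN opprK -wedgeE.
Qed.

Lemma e3E (R : realType) (x : C3 R) :
  e3 x = vwedge (basis c2) (vfieldU 0 1 0 x).
Proof.
have -> : vfieldU 0 1 0 x = x 0 c0 *: basis c0.
  by rewrite /vfieldU mul0r add0r mul1r /row3 !scale0r !addr0.
by rewrite vwedgeZr -wedgeE.
Qed.

(** * Zeros of the four structures *)

Lemma zeros_e1 (R : realType) (P : poisson_structure R) : P false =1 @e1 R ->
  forall a x, P a x = 0 <-> a = true /\ x 0 c0 = 0.
Proof.
move=> PU a x.
have PU' y : P false y = vwedge (basis c2) (vfieldU 1 0 0 y) by rewrite -e1E PU.
case: a; last first.
  rewrite PU'; split=> [/vwedge_e2_eq0 [/eqP]|[]//].
  by rewrite mul0r addr0 oner_eq0.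
rewrite (vfield_poisson_V PU'); split=> [/vwedge_e2_eq0[/eqP]|[_ x0]].
  by rewrite mul0r addr0 mul1r oppr_eq0 expf_eq0 /= => /eqP.
by apply/vwedge_e2_eq0; rewrite x0 expr0n !mulr0 !addr0 oppr0 mulr0 mul0r.
Qed.

Lemma e2_charts (R : realType) (P : poisson_structure R) : P false =1 @e2 R ->
  forall a (x : C3 R), P a x = vwedge (basis c2) (row3 0 (- x 0 c1) 0).
Proof.
move=> PU a x.
have PU' y : P false y = vwedge (basis c2) (vfieldU 0 0 (-1) y).
  by rewrite -e2E PU.
have -> : row3 0 (- x 0 c1) 0 = vfieldU 0 0 (-1) x.
  by rewrite /vfieldU mul0r addr0 mulN1r.
case: a; last exact: PU'.
rewrite (vfield_poisson_V PU').
have -> // : vfieldV 0 0 (-1) x = vfieldU 0 0 (-1) x.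
by rewrite /vfieldV /vfieldU !(mul0r, addr0, mulr0, add0r, oppr0).
Qed.

Lemma zeros_e2 (R : realType) (P : poisson_structure R) : P false =1 @e2 R ->
  forall a x, P a x = 0 <-> x 0 c1 = 0.
Proof.
move=> PU a x; rewrite (e2_charts PU); split=> [/vwedge_e2_eq0[_ /eqP]|x1].
  by rewrite oppr_eq0 => /eqP.
by apply/vwedge_e2_eq0; rewrite x1 oppr0.
Qed.

Lemma zeros_e3 (R : realType) (P : poisson_structure R) : P false =1 @e3 R ->
  forall a x, P a x = 0 <-> x 0 c0 = 0 /\ (a -> x 0 c1 = 0).
Proof.
move=> PU a x.
have PU' y : P false y = vwedge (basis c2) (vfieldU 0 1 0 y) by rewrite -e3E PU.
case: a; last first.
  rewrite PU'; split=> [/vwedge_e2_eq0 []|[x0 _]].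
    by rewrite mul1r add0r.
  by apply/vwedge_e2_eq0; rewrite x0 mul1r add0r mul0r.
rewrite (vfield_poisson_V PU'); split=> [/vwedge_e2_eq0[/eqP]|[x0 /(_ isT) x1]].
  rewrite mul0r mul1r add0r oppr_eq0 => /eqP x0 /eqP.
  rewrite mul0r add0r mulr1 addr0 mulf_eq0 pnatr_eq0 /= => /eqP x1.
  by split.
by apply/vwedge_e2_eq0; rewrite x0 x1 !mulr0 mul0r addr0 oppr0.
Qed.

Lemma zeros_e4 (R : realType) (P : poisson_structure R) : P false =1 @e4 R ->
  forall a x, P a x <> 0.
Proof.
move=> PU a x.
have n0 := @vwedge_e01_neq0 (Cplx R).
case: a; last by rewrite PU /e4 wedgeE.
have [Q [QU QV]] := e4_poisson R.
rewrite (poisson_determined (Q := Q)); last by move=> y; rewrite PU QU.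
by rewrite QV wedgeE => /eqP; rewrite oppr_eq0 => /eqP.
Qed.

(** * The charts of W2 *)

Lemma pair_continuous (R : realType) (a : bool) :
  continuous (fun y : C3 R => (a, y)).
Proof.
move=> x P /= [[A B] /= [HA HB] AB].
rewrite /= nbhs_filterE /=; apply: filterS HB => y By.
by apply: AB; split => //=; exact: nbhs_singleton HA.
Qed.

Lemma chart_eqP (R : realType) a b (x y : C3 R) : chart a x = chart b y <->
   if a == b then x = y else (x 0 c0 != 0) /\ y = transition x.
Proof.
have E : reflect (chart a x = chart b y) (glued (a, x) (b, y)).
  exact: (@eqmodP _ (glued_equiv R) (a, x) (b, y)).
split=> [/E|H]; [|apply/E]; rewrite /glued /=.
  by case: eqVneq => _; [move/eqP | case/andP => ? /eqP].
by case: eqVneq H => _ => [->|[-> ->]]; rewrite eqxx //.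
Qed.

Lemma chartP (R : realType) (p : W2 R) : exists a x, p = chart a x.
Proof.
by exists (repr p).1, (repr p).2; rewrite /chart -surjective_pairing reprK.
Qed.

Lemma chart_invK (R : realType) b (x : C3 R) : chart_inv b (chart b x) = x.
Proof.
rewrite /chart_inv; case: xgetP => [y _ /chart_eqP|/(_ x)]; last by case.
by rewrite eqxx.
Qed.

Lemma chart_continuous (R : realType) a : continuous (@chart R a).
Proof.
move=> x; apply: (continuous_comp (@pair_continuous R a x)).
exact: pi_continuous.
Qed.

Lemma chart_open (R : realType) b : open (range (@chart R b)).
Proof.
rewrite /open /= /quotient_open.
have -> : (\pi_(W2 R) @^-1` range (@chart R b))%qT =
   ((fst @^-1` [set b]) `|` (fun p : bool * C3 R => p.2 0 c0) @^-1` [set~ 0]).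
  apply/seteqP; split => [[a x] /= [y _ /chart_eqP]|[a x] /= [->|/eqP x0]].
  - rewrite eq_sym; case: eqVneq => [-> _|_ [y0 ->]]; first by left.
    by right; apply/eqP; rewrite transition0 invr_eq0.
  - by exists x.
  - have [->|ab] := eqVneq a b; first by exists x.
    exists (transition x) => //; apply/esym/chart_eqP.
    by rewrite (negPf ab).
apply: openU.
  by apply: open_comp; [move=> p _; exact: cvg_fst|exact: discrete_open].
apply: open_comp.
  move=> p _; apply: (@continuous_comp _ _ _ snd (fun x : C3 R => x 0 c0)).
    exact: cvg_snd.
  exact: coord_continuous.
apply: closed_openC; apply: accessible_closed_set1.
exact/hausdorff_accessible/norm_hausdorff.
Qed.

(** * Biholomorphisms and Poisson isomorphisms *)

Lemma local_exprP (R : realType) (phi : W2 R -> W2 R) a b x y :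
  phi (chart a x) = chart b y -> local_expr phi a b x = y.
Proof. by move=> E; rewrite /local_expr /= E chart_invK. Qed.

(** The charts having open images, a local expression represents the map on a
    whole neighbourhood, so that its derivatives are those of the map. *)
Lemma near_chart (R : realType) (phi : W2 R -> W2 R) a b x y :
  continuous phi -> phi (chart a x) = chart b y ->
  \forall x' \near x, phi (chart a x') = chart b (local_expr phi a b x').
Proof.
move=> cphi E.
have C : continuous (phi \o @chart R a).
  by move=> z; apply: continuous_comp; [exact: chart_continuous|exact: cphi].
have H : nbhs (phi (chart a x)) (range (@chart R b)).
  by apply: open_nbhs_nbhs; split; [exact: chart_open|exists y].
have {}H : \forall x' \near x, range (@chart R b) (phi (chart a x')) := C x _ H.
near=> x'.
have [z _ /esym ez] : range (@chart R b) (phi (chart a x')) by near: x'.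
by rewrite (local_exprP ez).
Unshelve. all: by end_near.
Qed.

Lemma local_expr_differentiable (R : realType) (phi : W2 R -> W2 R) a b x y :
  holomorphic phi -> phi (chart a x) = chart b y ->
  differentiable (local_expr phi a b) x.
Proof. by move=> [_ h] E; apply: h; exists y. Qed.

Lemma jacobian_inverse (R : realType) (phi psi : W2 R -> W2 R) a b x y :
  holomorphic phi -> holomorphic psi -> cancel phi psi ->
  phi (chart a x) = chart b y ->
  'J (local_expr phi a b) x *m 'J (local_expr psi b a) y = 1%:M.
Proof.
move=> hphi hpsi K E.
have E' : psi (chart b y) = chart a x by rewrite -E K.
have df := local_expr_differentiable hphi E.
have := local_expr_differentiable hpsi E'.
rewrite -(local_exprP E) => dg.
rewrite -(jacobian_comp df dg).
apply: (jacobian_near_id (differentiable_comp df dg)).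
have [cphi _] := hphi.
near=> x'.
have Ex' : phi (chart a x') = chart b (local_expr phi a b x').
  by near: x'; exact: (near_chart cphi E).
by apply: local_exprP; rewrite -Ex' K.
Unshelve. all: by end_near.
Qed.

Lemma pushforward_inverse (R : realType) (phi psi : W2 R -> W2 R)
    (P Q : poisson_structure R) :
  holomorphic phi -> holomorphic psi -> cancel phi psi -> cancel psi phi ->
  is_pushforward phi P Q -> is_pushforward psi Q P.
Proof.
move=> hphi hpsi K K' H a b x [y _ E].
have E' : phi (chart b y) = chart a x by rewrite E K'.
rewrite (local_exprP (esym E)) -(local_exprP E') H; last by exists x.
rewrite push_inverse // (local_exprP E').
exact: jacobian_inverse E'.
Qed.

Lemma poisson_isomorphic_sym (R : realType) (P Q : poisson_structure R) :
  poisson_isomorphic P Q -> poisson_isomorphic Q P.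
Proof.
move=> [phi [[hphi [psi [hpsi K K']]] H]]; exists psi; split.
  by split => //; exists phi.
exact: pushforward_inverse H.
Qed.

Lemma pushforward_zero (R : realType) (phi : W2 R -> W2 R)
    (P Q : poisson_structure R) a b x y :
  is_pushforward phi P Q -> phi (chart a x) = chart b y ->
  P a x = 0 -> Q b y = 0.
Proof.
move=> H E P0; rewrite -(local_exprP E) H; last by exists y.
by rewrite P0 /push mulmx0 mul0mx.
Qed.

Lemma pushforward_zeroP (R : realType) (P Q : poisson_structure R)
    (phi psi : W2 R -> W2 R) a b x y :
  holomorphic phi -> holomorphic psi -> cancel phi psi -> cancel psi phi ->
  is_pushforward phi P Q -> phi (chart a x) = chart b y ->
  P a x = 0 <-> Q b y = 0.
Proof.
move=> hphi hpsi K K' PQ E; split; first exact: (pushforward_zero PQ E).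
apply: (pushforward_zero (pushforward_inverse hphi hpsi K K' PQ)).
by rewrite -E K.
Qed.

(** * Real lines in complex spaces *)

Lemma real_complex_continuous (R : realType) :
  continuous (fun r : R => (r%:C)%C : Cplx R).
Proof.
move=> r; apply/cvgrPdist_lt => e e0.
have [s es] : exists s : R, e = (s%:C)%C.
  by exists (complex.Re e); rewrite RRe_real // gtr0_real.
have s0 : 0 < s by rewrite -ltcR -es.
near=> t.
rewrite -(rmorphB (real_complex R)) /= es.
have -> : `|((r - t)%:C)%C : Cplx R| = (`|r - t|%:C)%C.
  by rewrite normc_def /= expr0n addr0 sqrtr_sqr.
rewrite ltcR; near: t.
by exists s.
Unshelve. all: by end_near.
Qed.

Lemma Re_continuous (R : realType) :
  continuous (fun z : Cplx R => complex.Re z).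
Proof.
move=> z; have FZ : Filter (nbhs z) := nbhs_filter z.
apply/cvgrPdist_lt => e e0.
near=> w.
rewrite -ltcR -(raddfB (@complex.Re R)) /=.
apply: le_lt_trans (normc_ge_Re _) _.
near: w.
by exists (e%:C)%C => //=; rewrite ltcR.
Unshelve. all: by end_near.
Qed.

Definition real_line (R : realType) (V : normedModType (Cplx R)) 
    (x v : V) (s : R) : V :=
  (s%:C)%C *: v + x.

Lemma real_line_continuous (R : realType) (V : normedModType (Cplx R))
    (x v : V) :
  continuous (real_line x v).
Proof.
have C : continuous (fun k : Cplx R => k *: v + x).
  move=> k; apply: (@continuousD _ _ _ (fun h : Cplx R => h *: v) (cst x)).
    exact: scalel_continuous.
  exact: cst_continuous.
move=> s.
apply: (@continuous_comp R (Cplx R) V (fun r : R => (r%:C)%C)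
  (fun k => k *: v + x)).
  exact: real_complex_continuous.
exact: C.
Qed.

Lemma line_stays_in_open (R : realType) (T : topologicalType)
    (f : R -> T) (A B : set T) :
  continuous f -> open A -> open B ->
  (forall s, A (f s) \/ B (f s)) -> (forall s, A (f s) -> ~ B (f s)) ->
  forall s t, A (f s) -> A (f t).
Proof.
move=> cf oA oB AB nAB s t As.
have oA' : open (f @^-1` A) by apply: open_comp oA => u _; exact: cf.
have oB' : open (f @^-1` B) by apply: open_comp oB => u _; exact: cf.
have cA : closed (f @^-1` A).
  rewrite (_ : f @^-1` A = ~` (f @^-1` B)); first exact: open_closedC.
  by apply/seteqP; split => u /= ; [exact: nAB|case: (AB u)].
have conn : connected [set: R] by apply/connected_intervalP => a b _ _ c _.
have E : f @^-1` A = [set: R].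
  apply: conn; first by exists s.
    by exists (f @^-1` A) => //; rewrite setTI.
  by exists (f @^-1` A) => //; rewrite setTI.
by have : [set: R] t by []; rewrite -E.
Qed.

(** Meant for L the real part or the imaginary part: it turns a vanishing
    complex derivative into a vanishing real one, to which the mean value
    theorem applies. *)
Lemma is_derive0_real_line (R : realType) (V : normedModType (Cplx R))
    (L : Cplx R -> R) (F : V -> Cplx R) (x v : V) (s : R) :
  continuous L -> (forall z w : Cplx R, L (z - w) = L z - L w) ->
  (forall (r : R) (z : Cplx R), L ((r%:C)%C * z) = r * L z) ->
  is_derive (real_line x v s) v F 0 ->
  is_derive s 1 (fun t : R => L (F (real_line x v t))) 0.
Proof.
move=> cL LB LM [dF F0].
have /cvg_ex[l Hl] := dF.
have l0 : l = 0 by rewrite -F0; apply/esym; exact: cvg_lim Hl.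
rewrite {}l0 in Hl.
have HR : ((h%:C)%C : Cplx R) @[h --> (0 : R)^'] --> (0 : Cplx R)^'.
  move=> A /= [e e0 He].
  have [d d0 Hd] :=
    @real_complex_continuous R 0 _ (nbhsx_ballx (0 : Cplx R) e e0).
  exists d => //= h hd h0; apply: He; first exact: Hd.
  by move: h0; rewrite -(inj_eq (@complexI R)).
have L0 : L 0 = 0 by rewrite -(subrr (0 : Cplx R)) LB subrr.
pose g (t : R) := L (F (real_line x v t)).
have H : (fun h : R => h^-1 *: ((g \o shift s) (h *: 1) - g s))
    @ (0 : R)^' --> (0 : R).
  have E (h : R) : h^-1 *: ((g \o shift s) (h *: 1) - g s) =
    L (((h%:C)%C : Cplx R)^-1 *: ((F \o shift (real_line x v s))
        ((h%:C)%C *: v) - F (real_line x v s))).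
    have -> : (F \o shift (real_line x v s)) ((h%:C)%C *: v) =
        F (real_line x v (h + s)).
      by rewrite /= /real_line rmorphD scalerDl addrA.
    rewrite -(fmorphV (real_complex R)) [RHS]LM LB.
    by rewrite /= [h%:A]mulr1.
  rewrite (eq_cvg _ _ E).
  have := cvg_comp _ _ (cvg_comp _ _ HR Hl) (cL 0).
  by rewrite L0.
apply: DeriveDef; first by apply/cvg_ex; exists 0.
exact: cvg_lim H.
Qed.

(** The derivative is not controlled at the origin of the segment, where
    continuity is enough for the mean value theorem. *)
Lemma eq_along_real_line (R : realType) (V : normedModType (Cplx R))
    (F : V -> Cplx R) (x v : V) :
  continuous F ->
  (forall s : R, s != 0 -> is_derive (real_line x v s) v F 0) ->
  F (v + x) = F x.
Proof.
move=> cF dF.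
have main (L : Cplx R -> R) : continuous L ->
    (forall z w : Cplx R, L (z - w) = L z - L w) ->
    (forall (r : R) (z : Cplx R), L ((r%:C)%C * z) = r * L z) ->
    L (F (v + x)) = L (F x).
  move=> cL LB LM.
  pose g (s : R) := L (F (real_line x v s)).
  have dg (s : R) : s \in `]0, 1[%R -> is_derive s 1 g 0.
    rewrite in_itv /= => /andP[s0 _]; apply: (is_derive0_real_line cL LB LM).
    by apply: dF; rewrite gt_eqF.
  have cg : {within `[0, 1], continuous g}.
    apply: continuous_subspaceT => s.
    apply: (@continuous_comp R V R _ (L \o F)).
      exact: real_line_continuous.
    by apply: continuous_comp; [exact: cF|exact: cL].
  have [c _] := MVT ltr01 dg cg.
  by rewrite mul0r => /subr0_eq; rewrite /g /real_line scale1r scale0r add0r.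
have E (z w : Cplx R) : complex.Re z = complex.Re w ->
    complex.Im z = complex.Im w -> z = w.
  by case: z w => [a b] [c d] /= -> ->.
apply: E.
  apply: main; first exact: Re_continuous.
    by move=> z w; rewrite raddfB.
  by move=> r [a b] /=; rewrite mul0r subr0.
apply: (main (fun z => complex.Im z)).
- have -> : (fun z : Cplx R => complex.Im z) =
      (fun z : Cplx R => complex.Re z) \o (fun z => z * - 'i%C).
    apply/funext => -[a b] /=.
    by rewrite !(mulr0, mulr1, mulrN, oppr0, sub0r, opprK, mulrN1, add0r).
  move=> z; apply: continuous_comp; last exact: Re_continuous.
  exact: mulrr_continuous.
- by move=> z w; rewrite raddfB.
- by move=> r [a b] /=; rewrite mul0r addr0.
Qed.

(** * The Casimir function u1 *)

Definition chart_casimir (R : realType) (a : bool) (x : C3 R) : Cplx R :=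
  if a then x 0 c0 ^+ 2 * x 0 c1 else x 0 c1.

(** The function u1 of U, which extends to W2 by xi^2 v1 on V. *)
Definition casimir (R : realType) (p : W2 R) : Cplx R :=
  chart_casimir (repr p).1 (repr p).2.

Lemma chart_casimir_transition (R : realType) (a : bool) (x : C3 R) :
  x 0 c0 != 0 ->
  chart_casimir (~~ a) (transition x) = chart_casimir a x.
Proof.
move=> x0; rewrite /chart_casimir; case: a; rewrite /= !transitionE //.
by rewrite mulrA -exprMn mulVf // expr1n mul1r.
Qed.

Lemma casimir_chart (R : realType) (a : bool) (x : C3 R) :
  casimir (chart a x) = chart_casimir a x.
Proof.
rewrite /casimir; set q := repr _.
have E : chart a x = chart q.1 q.2.
  by rewrite /chart -surjective_pairing /q reprK.
move/chart_eqP: E; case: eqVneq => [-> ->|aq [x0 ->]] //.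
have -> : q.1 = ~~ a by move: aq; case: (q.1); case: (a).
exact: chart_casimir_transition.
Qed.

Lemma chart_casimir_continuous (R : realType) a :
  continuous (@chart_casimir R a).
Proof.
have D (x : C3 R) i := differentiable_coordinate x i.
case: a => x; last exact: coord_continuous.
apply: differentiable_continuous.
exact: (differentiableM (differentiableX 1 (D x c0)) (D x c1)).
Qed.

Lemma casimir_continuous (R : realType) : continuous (@casimir R).
Proof.
apply/continuousP => O oO; rewrite /open /= /quotient_open.
have -> : (\pi_(W2 R) @^-1` (@casimir R @^-1` O))%qT =
  \bigcup_a ((fst @^-1` [set a]) `&` (snd @^-1` (@chart_casimir R a @^-1` O))).
  apply/seteqP; split => [[a x] /= h|[a x] /= [b _ [/= -> h]]].
    by exists a => //; split => //=; rewrite -casimir_chart.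
  by have := casimir_chart b x; rewrite /chart => ->.
apply: bigcup_open => a _; apply: openI.
  by apply: open_comp; [move=> p _; exact: cvg_fst|exact: discrete_open].
apply: open_comp; first by move=> p _; exact: cvg_snd.
by apply: open_comp oO => y _; exact: chart_casimir_continuous.
Qed.

(** * The four structures are not isomorphic *)

(** The function u1 o phi is constant along the lines of direction d/du1 (resp.
    d/dv1), and it vanishes on the zeros of e2, which all these lines meet. *)
Lemma e2_not_iso_e1 (R : realType) (P Q : poisson_structure R) :
  P false =1 @e2 R -> Q false =1 @e1 R -> ~ poisson_isomorphic P Q.
Proof.
move=> PE QE [phi [[hphi [psi [hpsi K K']]] PQ]].
have Z a b x y := pushforward_zeroP (a := a) (b := b) (x := x) (y := y)
  hphi hpsi K K' PQ.
pose F a (x : C3 R) := casimir (phi (chart a x)).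
have cphi : continuous phi by have [] := hphi.
have cF a : continuous (F a).
  move=> x; apply: (@continuous_comp _ _ _ (phi \o chart a) (@casimir R)).
    by apply: continuous_comp; [exact: chart_continuous|exact: cphi].
  exact: casimir_continuous.
(* Zeros of e2 go to zeros of e1, that is, to xi = 0, where u1 = xi^2 v1
   vanishes. *)
have F0 a (x : C3 R) : x 0 c1 = 0 -> F a x = 0.
  move=> x1; have [b [y E]] := chartP (phi (chart a x)).
  have /(zeros_e1 QE)[bT y0] : Q b y = 0 by apply/(Z _ _ _ _ E)/(zeros_e2 PE).
  by rewrite /F E bT casimir_chart /chart_casimir y0 expr0n mul0r.
have dF a (p : C3 R) : p 0 c1 != 0 ->
    forall k : Cplx R, is_derive p (k *: basis c1) (F a) 0.
  move=> p1 k.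
  (* The image of p is not a zero of e1, so it lies in U. *)
  have [y E] : exists y, phi (chart a p) = chart false y.
    have [b [y E]] := chartP (phi (chart a p)).
    case: b E => E; last by exists y.
    have [y0|y0] := eqVneq (y 0 c0) 0; last first.
      by exists (transition y); rewrite E; apply/chart_eqP.
    have /(Z _ _ _ _ E)/(zeros_e2 PE) p1' : Q true y = 0 by apply/(zeros_e1 QE).
    by rewrite p1' eqxx in p1.
  have df := local_expr_differentiable hphi E.
  have JJ := jacobian_inverse hphi hpsi K E.
  set J := 'J (local_expr phi a false) p in JJ.
  have J1 : (basis c1 *m J) 0 c1 = 0.
    apply: (@vwedge_mul_coord_eq0 _ _ _ (- p 0 c1) (basis c0) JJ).
      by rewrite oppr_eq0.
      by rewrite (congr1 (fun u : 'rV_3 => u 0 c1) (basis0E _)) row3E.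
    have := PQ a false p; rewrite (local_exprP E) -/J QE (e2_charts PE).
    rewrite push_vwedge /e1 wedgeE => ->; last by exists y.
    rewrite scalemxAl; congr (vwedge _ (_ *m _)).
    by rewrite basis1E /row3 !scale0r !addr0 !add0r scale1r.
  have d1 : is_derive p (k *: basis c1)
      (fun x => local_expr phi a false x 0 c1 : Cplx R) 0.
    apply: DeriveDef.
      exact/diff_derivable/(differentiable_entry 0 c1 df).
    rewrite (derive_entry _ _ _ df) (deriveEjacobian _ df) -scalemxAl mxE.
    rewrite -/J J1.
    exact: mulr0.
  apply: near_eq_is_derive d1.
  near=> x'.
  have Ex' : phi (chart a x') = chart false (local_expr phi a false x').
    by near: x'; exact: (near_chart cphi E).
  by rewrite /F Ex' casimir_chart.
(* The real segment from (x_0, 0, x_2) to x meets the plane x_1 = 0 at its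
   origin only. *)
have F00 a (x : C3 R) : F a x = 0.
  have [x1|x1] := eqVneq (x 0 c1) 0; first exact: F0.
  pose x' : C3 R := row3 (x 0 c0) 0 (x 0 c2).
  have -> : x = x 0 c1 *: basis c1 + x'.
    apply: eq_row3; rewrite mxE row3E basis1E.
    - by rewrite mxE row3E mulr0 add0r.
    - by rewrite mxE row3E mulr1 addr0.
    - by rewrite mxE row3E mulr0 add0r.
  apply: etrans (eq_along_real_line (cF a) _) (F0 a x' _); last first.
    by rewrite row3E.
  move=> s s0; apply: dF.
  rewrite /real_line scalerA mxE row3E addr0 basis1E mxE row3E mulr1.
  by rewrite mulf_neq0 //; apply: contra_neq s0 => /complexI.
(* Yet the point (0, 1, 0) of U, where u1 = 1, is an image. *)
have [a [x E]] := chartP (psi (chart false (row3 0 1 0))).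
have := F00 a x; rewrite /F -E K' casimir_chart /chart_casimir row3E => /eqP.
by rewrite oner_eq0.
Unshelve. all: by end_near.
Qed.

(** The zeros of e3 in U (z = 0) and those in V (xi = v1 = 0) are disjoint, and
    both are open among the zeros of e3.  A line contained in the zeros of P is
    mapped into these zeros, and thus stays on one side. *)
Lemma zero_plane_side (R : realType) (P Q : poisson_structure R)
    (phi psi : W2 R -> W2 R) (a : bool) (i : 'I_3) :
  Q false =1 @e3 R ->
  holomorphic phi -> holomorphic psi -> cancel phi psi -> cancel psi phi ->
  is_pushforward phi P Q ->
  (forall x : C3 R, x 0 i = 0 -> P a x = 0) ->
  forall x y : C3 R, x 0 i = 0 -> y 0 i = 0 ->
  range (@chart R false) (phi (chart a x)) ->
  range (@chart R false) (phi (chart a y)).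
Proof.
move=> QE hphi hpsi K K' PQ P0 x y xi yi.
pose f := phi \o @chart R a \o real_line x (y - x).
have cphi : continuous phi by have [] := hphi.
have cf : continuous f.
  move=> s.
  apply: (@continuous_comp _ _ _ (real_line x (y - x)) (phi \o chart a)).
    exact: real_line_continuous.
  by apply: continuous_comp; [exact: chart_continuous|exact: cphi].
have line0 s : P a (real_line x (y - x) s) = 0.
  by apply: P0; rewrite /real_line !mxE xi yi subr0 mulr0 addr0.
have := line_stays_in_open cf (@chart_open R false) (@chart_open R true).
have -> : f = fun s => phi (chart a (real_line x (y - x) s)) by [].
move=> sep; have := sep _ _ 0 1.
rewrite /real_line rmorph0 rmorph1 scale0r add0r scale1r subrK; apply.
  move=> s.
  have [[] [z E]] := chartP (phi (chart a (real_line x (y - x) s))).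
    by right; exists z.
  by left; exists z.
move=> s [z _ E] [w _ E'].
have /(zeros_e3 QE)[z0 _] : Q false z = 0.
  exact/(pushforward_zeroP hphi hpsi K K' PQ (esym E))/line0.
by have /chart_eqP := etrans E (esym E'); rewrite /= z0 eqxx => -[].
Qed.

Lemma e3_zeros_separated (R : realType) (P Q : poisson_structure R)
    (phi psi : W2 R -> W2 R) :
  Q false =1 @e3 R ->
  holomorphic phi -> holomorphic psi -> cancel phi psi -> cancel psi phi ->
  is_pushforward phi P Q ->
  exists a x b y, [/\ P a x = 0, P b y = 0,
    range (@chart R false) (phi (chart a x)) &
    ~ range (@chart R false) (phi (chart b y))].
Proof.
move=> QE hphi hpsi K K' PQ.
have Q0 a : Q a 0 = 0 by apply/(zeros_e3 QE); rewrite !mxE.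
have [a [x Ex]] := chartP (psi (chart false 0)).
have [b [y Ey]] := chartP (psi (chart true 0)).
have Fx : phi (chart a x) = chart false 0 by rewrite -Ex K'.
have Fy : phi (chart b y) = chart true 0 by rewrite -Ey K'.
exists a, x, b, y; split.
- exact/(pushforward_zeroP hphi hpsi K K' PQ Fx)/Q0.
- exact/(pushforward_zeroP hphi hpsi K K' PQ Fy)/Q0.
- by rewrite Fx; exists 0.
- by rewrite Fy => -[z _ /esym /chart_eqP] /=; rewrite mxE eqxx => -[].
Qed.

Lemma e1_not_iso_e3 (R : realType) (P Q : poisson_structure R) :
  P false =1 @e1 R -> Q false =1 @e3 R -> ~ poisson_isomorphic P Q.
Proof.
move=> PE QE [phi [[hphi [psi [hpsi K K']]] PQ]].
have [a [x [b [y [/(zeros_e1 PE)[-> x0] /(zeros_e1 PE)[-> y0] Ux]]]]] :=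
  e3_zeros_separated QE hphi hpsi K K' PQ.
apply; apply: (zero_plane_side QE hphi hpsi K K' PQ _ x0 y0 Ux) => z z0.
by apply/(zeros_e1 PE).
Qed.

Lemma e2_not_iso_e3 (R : realType) (P Q : poisson_structure R) :
  P false =1 @e2 R -> Q false =1 @e3 R -> ~ poisson_isomorphic P Q.
Proof.
move=> PE QE [phi [[hphi [psi [hpsi K K']]] PQ]].
have [a [x [b [y [/(zeros_e2 PE) x0 /(zeros_e2 PE) y0 Ux]]]]] :=
  e3_zeros_separated QE hphi hpsi K K' PQ.
apply.
have side c (u v : C3 R) : u 0 c1 = 0 -> v 0 c1 = 0 ->
    range (@chart R false) (phi (chart c u)) ->
    range (@chart R false) (phi (chart c v)).
  by apply: (zero_plane_side QE hphi hpsi K K' PQ) => z /(zeros_e2 PE).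
(* The point (1, 0, 0) of U also lies in V, and links the planes u1 = 0 and
   v1 = 0. *)
pose m : bool -> C3 R :=
  fun c => if c then transition (row3 1 0 0) else row3 1 0 0.
have mE : chart true (m true) = chart false (m false).
  by apply/esym/chart_eqP; rewrite /= row3E oner_neq0.
have m1 c : m c 0 c1 = 0 by case: c; rewrite /m ?transitionE ?row3E ?mulr0.
apply: (side b (m b) y (m1 b) y0).
have -> : chart b (m b) = chart a (m a) by case: (a); case: (b); rewrite ?mE.
exact: side Ux.
Qed.

Lemma e4_not_iso (R : realType) (P Q : poisson_structure R) a x :
  P a x = 0 -> Q false =1 @e4 R -> ~ poisson_isomorphic P Q.
Proof.
move=> P0 QE [phi [_ PQ]].
have [b [y E]] := chartP (phi (chart a x)).
exact: (zeros_e4 QE) (pushforward_zero PQ E P0).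
Qed.

Theorem corollary4p4 (R : realType) :
  (forall i : 'I_4, exists P : poisson_structure R, extends P (brackets i)) /\
  (forall (i j : 'I_4) (P Q : poisson_structure R),
     i <> j -> extends P (brackets i) -> extends Q (brackets j) ->
     ~ poisson_isomorphic P Q).
Proof.
split.
  case=> [[|[|[|[|i]]]] hi] //.
  - have [P [PU _]] := vfield_poisson (1 : Cplx R) 0 0.
    by exists P => x; rewrite PU -e1E.
  - have [P [PU _]] := vfield_poisson (0 : Cplx R) 0 (-1).
    by exists P => x; rewrite PU -e2E.
  - have [P [PU _]] := vfield_poisson (0 : Cplx R) 1 0.
    by exists P => x; rewrite PU -e3E.
  - by have [P [PU _]] := e4_poisson R; exists P.
have main (i j : 'I_4) (P Q : poisson_structure R) : (i < j)%N ->
    extends P (brackets i) -> extends Q (brackets j) ->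
    ~ poisson_isomorphic P Q.
  rewrite /extends /brackets.
  case: i j => [[|[|[|[|i]]]] hi] [[|[|[|[|j]]]] hj] //= _ PE QE.
  - by move/poisson_isomorphic_sym; exact: e2_not_iso_e1 QE PE.
  - exact: e1_not_iso_e3 PE QE.
  - apply: (e4_not_iso (a := true) (x := 0)) QE.
    by apply/(zeros_e1 PE); rewrite mxE.
  - exact: e2_not_iso_e3 PE QE.
  - apply: (e4_not_iso (a := true) (x := 0)) QE.
    by apply/(zeros_e2 PE); rewrite mxE.
  - apply: (e4_not_iso (a := false) (x := 0)) QE.
    by apply/(zeros_e3 PE); rewrite !mxE.
move=> i j P Q ij PE QE.
have [lt|lt|/val_inj//] := ltngtP i j; first exact: main PE QE.
by move/poisson_isomorphic_sym; exact: main QE PE.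
Qed.
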